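(* Assume $\mathfrak{a} = \mathfrak{c}$. Then there is a MAD family $\mathcal{A} \subset \omega^\omega$ with trivial trace.
   Context: Functions are identified with their graphs (subsets of $\omega\times\omega$). An a.d. family $\mathcal{A} \subset \omega^\omega$ is one with $|f \cap g| < \omega$ for distinct $f,g\in\mathcal{A}$; it is a MAD family in $\omega^\omega$ if moreover every $f \in \omega^\omega$ satisfies $|f \cap h| = \omega$ for some $h \in \mathcal{A}$. $\mathfrak{a}$ is the least size of an infinite maximal almost disjoint family of infinite subsets of $\omega$, and $\mathfrak{c} = 2^{\aleph_0}$. For $f \in \omega^\omega$, a MAD family on $f$ is an a.d. family of infinite subsets of $f$ such that every infinite subset of $f$ meets some member in an infinite set (the family may be finite). $\mathcal{A} \cap f = \{f \cap h : h \in \mathcal{A},\ |f\cap h| = \omega\}$, and $\mathrm{tr}(\mathcal{A}) = \{f \in \omega^\omega : \mathcal{A}\cap f \text{ is a MAD family on } f\}$. A set $X \in [\omega\times\omega]^\omega$ avoids $\mathcal{A}$ if for every finite $\{h_0,\dots,h_n\}\subset\mathcal{A}$, $|X \setminus (h_0\cup\dots\cup h_n)| = \omega$. $\mathcal{A}$ has trivial trace if no member of $\mathrm{tr}(\mathcal{A})$ avoids $\mathcal{A}$. *)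

(* Defs.v *)
From mathcomp Require Import all_boot.
From mathcomp Require Import all_classical.

Set Implicit Arguments.
Unset Strict Implicit.
Unset Printing Implicit Defensive.

Local Open Scope classical_set_scope.
Local Open Scope card_scope.

Definition almost_disjoint (T : Type) (B : set (set T)) : Prop :=
  forall b b' : set T, B b -> B b' -> b <> b' -> finite_set (b `&` b').

(* B may be finite, e.g. B = [set X]. *)
Definition mad_on (T : Type) (X : set T) (B : set (set T)) : Prop :=
  [/\ forall b : set T, B b -> b `<=` X /\ infinite_set b,
      almost_disjoint B &
      forall Y : set T, Y `<=` X -> infinite_set Y ->
        exists2 b : set T, B b & infinite_set (Y `&` b)].

(* Cardinals are represented by sets: the least cardinality of a member of F
   exists and equals that of C. *)
Definition least_card (T U : Type) (F : set (set T)) (C : set U) : Prop :=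
  (exists2 B : set T, F B & B #= C) /\ forall B : set T, F B -> C #<= B.

Definition infinite_mad_omega : set (set (set nat)) :=
  [set B | infinite_set B /\ mad_on [set: nat] B].

(* The continuum is the cardinality of the power set of nat. *)
Definition a_eq_c : Prop := least_card infinite_mad_omega [set: set nat].

Definition graph (f : nat -> nat) : set (nat * nat) := [set p | p.2 = f p.1].

Definition mad_functions (A : set (nat -> nat)) : Prop :=
  almost_disjoint (graph @` A) /\
  forall f : nat -> nat,
    exists2 h : nat -> nat, A h & infinite_set (graph f `&` graph h).

Definition trace_on (A : set (nat -> nat)) (f : nat -> nat) :
    set (set (nat * nat)) :=
  [set graph f `&` graph h |
    h in [set h | A h /\ infinite_set (graph f `&` graph h)]].

Definition tr (A : set (nat -> nat)) : set (nat -> nat) :=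
  [set f | mad_on (graph f) (trace_on A f)].

Definition avoids (X : set (nat * nat)) (A : set (nat -> nat)) : Prop :=
  infinite_set X /\
  forall H : set (nat -> nat), finite_set H -> H `<=` A ->
    infinite_set (X `\` \bigcup_(h in H) graph h).

Definition trivial_trace (A : set (nat -> nat)) : Prop :=
  forall f : nat -> nat, tr A f -> ~ avoids (graph f) A.

(* Main.v *)
Require Import Defs.
From mathcomp Require Import all_boot.
From mathcomp Require Import all_classical.
From mathcomp Require wochoice.

(* Fix continuum many almost disjoint branches through a tree and a free
   ultrafilter U.  Enumerate the functions f in a well-order whose proper
   initial segments have size < c.  At stage f one adds a set H f, empty or the
   graph of a member of the family, and a promise P f, an infinite partial
   function (or the empty set) that every member has to meet in a finite set.
   If f meets no earlier H infinitely, then, as its earlier promises have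
   domains outside U, finitely many of them cannot cover f, so by a = c some
   infinite b within f is almost disjoint from them.  Half of b, completed to
   a total function by a fresh branch, gives H f, and the other half gives P f.
   If f meets some earlier H infinitely but avoids the earlier H and meets the
   earlier promises finitely, a = c gives a new promise within f.  A promise
   within f shows that the trace on f is not maximal.
   Shrinking each b and each promise so that it meets at most one branch
   infinitely is what keeps a fresh branch available. *)

Set Implicit Arguments.
Unset Strict Implicit.
Unset Printing Implicit Defensive.

Local Open Scope classical_set_scope.
Local Open Scope card_scope.

(** * Recursion along a well-order with segments smaller than c *)

Definition small (T : Type) (D : set T) : Prop := ~ ([set: set nat] #<= D).

(** [xget] picks each value against the earlier ones, extended by the default [s0]. The default is
    harmless because the extensionality hypothesis lets [R] at [t] see only values below [t]. *)
Lemma wf_recursive_choice (T : Type) (S : choiceType) (lt : T -> T -> Prop)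
    (s0 : S) (R : T -> (T -> S) -> S -> Prop) :
  well_founded lt ->
  (forall t K K' x, (forall s, lt s t -> K s = K' s) -> R t K x -> R t K' x) ->
  (forall t K, (forall s, lt s t -> R s K (K s)) -> exists x, R t K x) ->
  exists K, forall t, R t K (K t).
Proof.
move=> wf Rext Rex.
pose ext t (rec : forall s, lt s t -> S) s :=
  if pselect (lt s t) is left p then rec s p else s0.
pose F t rec := xget s0 (R t (@ext t rec)).
pose K := Fix wf (fun _ => S : Type) F.
have KE t : K t = xget s0 (R t (ext t (fun s _ => K s))).
  rewrite /K Fix_eq // => u g g' gg'; congr (F u _).
  by apply: functional_extensionality_dep => s; apply/funext => p.
exists K => t; elim/(well_founded_ind wf): t => t IH.
have extK s : lt s t -> ext t (fun r _ => K r) s = K s.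
  by move=> st; rewrite /ext; case: pselect.
apply: (Rext _ _ _ _ extK); rewrite KE; apply: xgetPex.
by have [x Rx] := Rex t K IH; exists x; apply: Rext Rx => s /extK ->.
Qed.

(** If some initial segment has size at least c, [W] injects into the first such segment, and the
    order pulled back along the injection has only small segments. *)
Lemma small_segments_order (W : pointedType) : [set: W] #<= [set: set nat] ->
  exists lt : W -> W -> Prop,
    [/\ well_founded lt,
        forall s t, s <> t -> lt s t \/ lt t s &
        forall t, small [set s | lt s t]].
Proof.
move=> Wc; have [R Rwo] := wochoice.well_ordering_principle {eclassic W}.
have least (A : set W) : A !=set0 ->
    exists z, A z /\ forall y, A y -> R z y.
  move=> [a Aa]; have [|z [[zA zmin] _]] := Rwo (fun x => `[<A x>]).
    by exists a; apply/asboolP.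
  by exists z; split; [exact/asboolP|move=> y Ay; apply: zmin; apply/asboolP].
have Rtot x y : R x y \/ R y x.
  have [|z [[->|->] zmin]] := least [set x; y]; first by exists x; left.
    by left; apply: zmin; right.
  by right; apply: zmin; left.
(* Antisymmetry comes from the uniqueness of the least element of [[set x; y]]. *)
have Ranti x y : R x y -> R y x -> x = y.
  move=> xy yx; have xx : R x x by case: (Rtot x x).
  have yy : R y y by case: (Rtot y y).
  have [|z [_ zU]] := Rwo (fun z => `[<[set x; y] z>]).
    by exists x; apply/asboolP; left.
  have zx : z = x.
    by apply: zU; split; [apply/asboolP; left|move=> u /asboolP[]->].
  have zy : z = y.
    by apply: zU; split; [apply/asboolP; right|move=> u /asboolP[]->].
  by rewrite -zx.
pose lt x y := R x y /\ x <> y.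
have [g gI gsmall] : exists2 g : W -> W, injective g &
    forall t, small [set s | lt s (g t)].
  have [asm|/existsNP[t1 t1P]] := pselect (forall t, small [set s | lt s t]).
    by exists id.
  have [|t0 [t0P t0min]] := least [set t | ~ small [set s | lt s t]].
    by exists t1.
  have /pcard_leP[g] : [set: W] #<= [set s | lt s t0].
    by apply: card_le_trans Wc _; exact: contrapT.
  have gt0 t : lt (g t) t0 by exact: (@funS _ _ _ _ g t I).
  exists g; first by move=> x y; apply: inj; rewrite inE.
  move=> t; apply: contrapT => /t0min t0t.
  by have [/Ranti/(_ t0t)] := gt0 t.
exists (fun s t => lt (g s) (g t)); split.
- move=> t; apply: contrapT => tP.
  have [|_ [[z zP <-] zmin]] :=
      least (g @` [set t | ~ Acc (fun s t => lt (g s) (g t)) t]).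
    by exists (g t), t.
  apply: zP; constructor => y [yz yNz]; apply: contrapT => yP; apply: yNz.
  by apply: Ranti => //; apply: zmin; exists y.
- move=> s t st; have gst : g s <> g t by move/gI.
  by case: (Rtot (g s) (g t)) => ?; [left|right]; split => // /esym.
- move=> t; apply: contra_not (gsmall t) => /card_le_trans; apply.
  by apply: (@card_ge_preimage _ _ [set s | lt s (g t)]) => x y _ _; exact: gI.
Qed.

(** * Small almost disjoint families under a = c *)

Lemma split_infinite (T : pointedType) (S : set T) : infinite_set S ->
  exists S0 S1, [/\ S0 `<=` S, S1 `<=` S, S0 `&` S1 = set0,
    infinite_set S0 & infinite_set S1].
Proof.
move=> /infiniteP/pcard_leP[g].
have ginj m n : g m = g n -> m = n by move=> /inj; apply; rewrite inE.
have inf (k : nat -> nat) : injective k -> infinite_set (range (g \o k)).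
  move=> kI; apply/infiniteP.
  have : range (g \o k) #= [set: nat] by apply: inj_card_eq => m n _ _ /ginj/kI.
  by rewrite card_eq_le => /andP[].
exists (range (g \o double)), (range (g \o succn \o double)); split.
- by move=> _ [n _ <-]; exact: funS.
- by move=> _ [n _ <-]; exact: funS.
- rewrite -subset0 => _ [[m _ <-] [n _ /= /ginj]] e.
  by have := congr1 odd e; rewrite /= !odd_double.
- exact/inf/double_inj.
- by apply: (inf (succn \o double)) => m n [] /double_inj.
Qed.

(** If only finitely many [Q i] are infinite, the complement of their union serves as [b]. Otherwise
    the infinite ones form an infinite almost disjoint family of size below c = a, hence not a
    maximal one. *)
Lemma small_family_nonmaximal (T : Type) (D : set T) (Q : T -> set nat) :
  a_eq_c -> small D ->
  (forall i j, D i -> D j -> i <> j -> finite_set (Q i `&` Q j)) ->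
  (forall J, J `<=` D -> finite_set J ->
    infinite_set (~` \bigcup_(i in J) Q i)) ->
  exists2 b, infinite_set b & forall i, D i -> finite_set (b `&` Q i).
Proof.
move=> [_ amin] Dsmall Qad Qcov.
pose J := [set i | D i /\ infinite_set (Q i)].
have [Jfin|Jinf] := pselect (finite_set J).
  exists (~` \bigcup_(i in J) Q i); first by apply: Qcov => // i [].
  move=> i Di; have [Qf|Qi] := pselect (finite_set (Q i)).
    exact: finite_setIr.
  apply: (@sub_finite_set _ _ set0) => // n [/= nJ Qn].
  by apply: nJ; exists i.
apply: contrapT => noB; apply: Dsmall.
have Qinj : {in J &, injective Q}.
  move=> i j; rewrite !inE => -[Di Qi] [Dj Qj] QE; apply: contrapT => ij.
  by have := Qad _ _ Di Dj ij; rewrite -QE setIid.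
have JE : Q @` J #= J by exact: inj_card_eq.
apply: (@card_le_trans _ _ _ J); last by apply: subset_card_le => i [].
apply: (@card_le_trans _ _ _ (Q @` J)); last by case/card_eqPle: JE.
apply: amin; split; first by rewrite (eq_finite_set JE).
split.
- by move=> _ [i [_ Qi] <-].
- move=> _ _ [i [Di Qi] <-] [j [Dj Qj] <-] QQ; apply: Qad => // ij.
  by apply: QQ; rewrite ij.
- move=> Y _ Yinf; apply: contrapT => noY; apply: noB; exists Y => // i Di.
  have [Qf|Qi] := pselect (finite_set (Q i)); first exact: finite_setIr.
  by apply: contrapT => YQ; apply: noY; exists (Q i) => //; exists i.
Qed.

Lemma finite_graph_preimage (f : nat -> nat) (A : set (nat * nat)) :
  finite_set (graph f `&` A) <-> finite_set [set n | A (n, f n)].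
Proof.
split => Af.
  apply: sub_finite_set (finite_image fst Af) => n /= An.
  by exists (n, f n).
apply: sub_finite_set (finite_image (fun n => (n, f n)) Af).
move=> [n m] [gm An]; have mE : m = f n by [].
by rewrite mE in An *; exists n.
Qed.

Lemma small_family_nonmaximal_on (T : Type) (D : set T)
    (Q : T -> set (nat * nat)) (f : nat -> nat) :
  a_eq_c -> small D ->
  (forall i j, D i -> D j -> i <> j -> finite_set (Q i `&` Q j)) ->
  (forall J, J `<=` D -> finite_set J ->
    infinite_set (graph f `\` \bigcup_(i in J) Q i)) ->
  exists b, [/\ b `<=` graph f, infinite_set b &
    forall i, D i -> finite_set (b `&` Q i)].
Proof.
move=> aE Dsmall Qad Qcov.
have [|J JD Jf|b binf bQ] := @small_family_nonmaximal _ D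
  (fun i => [set n | Q i (n, f n)]) aE Dsmall.
- move=> i j Di Dj ij; apply/(finite_graph_preimage f (Q i `&` Q j)).
  exact/finite_setIr/Qad.
- apply: contra_not (Qcov J JD Jf); rewrite setDE.
  by move/(finite_graph_preimage f (~` \bigcup_(i in J) Q i)).
have inj : injective (fun n => (n, f n)) by move=> m n [].
have gb (A : set (nat * nat)) :
    ((fun n => (n, f n)) @` b) `&` A `<=` graph f `&` [set p | b p.1 /\ A p].
  by move=> _ [[n bn <-] An].
exists ((fun n => (n, f n)) @` b); split.
- by move=> _ [n _ <-].
- apply: contra_not binf => /(finite_image fst).
  by apply: sub_finite_set => n bn; exists (n, f n) => //; exists n.
- move=> i Di; apply: sub_finite_set (gb (Q i)) _.
  exact/finite_graph_preimage/bQ.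
Qed.

(** * Almost disjoint branches and free ultrafilters *)

Definition branch (K : countType) (x : nat -> K) (n : nat) : nat :=
  pickle (mkseq x n).

(** Once [x] and [y] differ at [k], their initial segments of length above [k] have different
    codes. *)
Lemma finite_branchI (K : countType) (x y : nat -> K) : x <> y ->
  finite_set (graph (branch x) `&` graph (branch y)).
Proof.
move=> xy; have [k xyk] : exists k, x k <> y k.
  apply: contrapT => /forallNP xyE; apply: xy; apply/funext => k.
  by apply: contrapT; exact: xyE.
apply: sub_finite_set (finite_image (fun n => (n, branch x n)) (finite_II k.+1)).
move=> [n m] [/= gx gy]; exists n => /=; last by rewrite -gx.
rewrite ltnS leqNgt; apply/negP => kn.
have /(pcan_inj pickleK) e : pickle (mkseq x n) = pickle (mkseq y n).
  by rewrite -[LHS]gx -[RHS]gy.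
by have := congr1 (fun s => nth (x 0) s k) e; rewrite !nth_mkseq.
Qed.

(** Cutting [S] down to some [E y] that it meets infinitely makes it almost disjoint from every
    other [E z]; if there is no such [y], [S] itself works. *)
Lemma thin_subset (X : Type) (E : X -> set (nat * nat)) (S : set (nat * nat)) :
  (forall x y, x <> y -> finite_set (E x `&` E y)) -> infinite_set S ->
  [set: X] !=set0 ->
  exists S' y, [/\ S' `<=` S, infinite_set S' &
    forall z, z <> y -> finite_set (S' `&` E z)].
Proof.
move=> Ead Sinf [x0 _].
have [[y Sy]|noy] := pselect (exists y, infinite_set (S `&` E y)).
  exists (S `&` E y), y; split => // z zy.
  by rewrite -setIA; apply: finite_setIr; apply: Ead => /esym.
by exists S, x0; split => // z _; apply: contrapT => Sz; apply: noy; exists z.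
Qed.

Lemma free_filter_infinite (U : set_system nat) (A : set nat) :
  ProperFilter U -> @frechet_filter nat `<=` U -> U A -> infinite_set A.
Proof.
move=> UF Ucofin UA Afin; apply: (@filter_not_empty _ U).
rewrite -(setICr A); apply: filterI => //; apply: Ucofin.
by rewrite /frechet_filter /= setCK.
Qed.

(** The complements of the finitely many domains intersect in a set of [U], infinite since [U] is
    free, and over it [f] escapes every [P i]. *)
Lemma coideal_domains_uncovered (U : set_system nat) (T : choiceType)
    (J : set T) (P : T -> set (nat * nat)) (f : nat -> nat) :
  ProperFilter U -> @frechet_filter nat `<=` U ->
  finite_set J -> (forall i, J i -> U (~` (fst @` P i))) ->
  infinite_set (graph f `\` \bigcup_(i in J) P i).
Proof.
move=> UF Ucofin Jfin PU; have : U (\bigcap_(i in J) ~` (fst @` P i)).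
  rewrite -(fset_setK Jfin); apply: filter_bigI => i.
  by rewrite in_fset_set // inE => /PU.
move=> /(free_filter_infinite UF Ucofin).
apply: contra_not => /(finite_image fst).
apply: sub_finite_set => n nP; exists (n, f n) => //; split => // -[i Ji Pi].
by apply: (nP i Ji); exists (n, f n).
Qed.

(** Disjoint halves of a partial function have disjoint domains, so the domain of one of them has
    its complement in [U]. *)
Lemma coideal_domain_subset (U : set_system nat) (f : nat -> nat)
    (S : set (nat * nat)) :
  UltraFilter U -> S `<=` graph f -> infinite_set S ->
  exists S', [/\ S' `<=` S, infinite_set S' & U (~` (fst @` S'))].
Proof.
move=> Uultra Sf /split_infinite[S0 [S1 [S0S S1S S01 S0inf S1inf]]].
have [U0|U0] := in_ultra_setVsetC (fst @` S0) Uultra; last by exists S0.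
exists S1; split => //; apply: filterS U0.
move=> _ [[n m] S0n <-] [[n' m'] S1n /= nn]; subst n'.
have mE : m = f n := Sf _ (S0S _ S0n).
have mE' : m' = f n := Sf _ (S1S _ S1n).
have : (S0 `&` S1) (n, m); last by rewrite S01.
by split => //; rewrite mE -mE'.
Qed.

(** * Choosing a fresh branch *)

Lemma diagonal_point (T : Type) (D : set T) (u : T -> set nat) :
  small D -> exists v, forall s, D s -> v <> u s.
Proof.
move=> Dsmall; apply: contrapT => /forallNP noV; apply: Dsmall.
apply: card_le_trans (card_image_le u D); apply: subset_card_le => v _.
by have /existsNP[s /not_implyP[Ds /contrapT ->]] := noV v; exists s.
Qed.

(** Indices of branches. Three coordinates serve to escape the three exceptional branches of each
    earlier stage, the fourth to escape one further branch [d]. *)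
Definition quad : Type := set nat * set nat * set nat * set nat.

(* One coordinate diagonalizes over each of [a], [b], [c]; this replaces the
   cardinal arithmetic [3 * |D| < c]. *)
Lemma diagonal_quad (T : Type) (D : set T) (a b c : T -> quad) (d : quad) :
  small D -> exists w : quad,
    w <> d /\ forall s, D s -> [/\ w <> a s, w <> b s & w <> c s].
Proof.
move=> Dsmall.
have [u uP] := diagonal_point (fun s => (a s).1.1.1) Dsmall.
have [v vP] := diagonal_point (fun s => (b s).1.1.2) Dsmall.
have [w wP] := diagonal_point (fun s => (c s).1.2) Dsmall.
exists (u, v, w, ~` d.2); split.
  move=> e; have {}e : (~` d.2) 0 = d.2 0 by rewrite -{2}e.
  have nd : ~ d.2 0 by move=> d0; move: (d0); rewrite -e.
  by apply: (nd); rewrite -e.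
move=> s Ds; split => e.
- by apply: (uP s Ds); rewrite -e.
- by apply: (vP s Ds); rewrite -e.
- by apply: (wP s Ds); rewrite -e.
Qed.

Definition quad_bits (x : quad) (n : nat) : bool * bool * bool * bool :=
  (`[<x.1.1.1 n>], `[<x.1.1.2 n>], `[<x.1.2 n>], `[<x.2 n>]).

Definition quad_branch (x : quad) : nat -> nat := branch (quad_bits x).

Lemma finite_quad_branchI (x y : quad) : x <> y ->
  finite_set (graph (quad_branch x) `&` graph (quad_branch y)).
Proof.
move=> xy; apply: finite_branchI => e; apply: xy.
case: x y e => [[[x1 x2] x3] x4] [[[y1 y2] y3] y4] e.
have E n : [/\ x1 n = y1 n, x2 n = y2 n, x3 n = y3 n & x4 n = y4 n].
  have [e1 e2 e3 e4] := congr1 (fun h => h n) e.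
  by split; apply/propext; exact: asbool_eq_equiv.
by congr (_, _, _, _); apply/funext => n; case: (E n).
Qed.

Local Notation quad_graph x := (graph (quad_branch x)).

(** * One stage of the construction *)

(** [stage_branches] and [stage_domain] keep later stages possible, and [stage_meets] gives
    maximality. [stage_trace] rules [f] out of a nontrivial trace: [f] meets a promise infinitely,
    or finitely many earlier [H s] cover [f] up to a finite set, so [f] does not avoid the
    family. *)
Record stage (U : set_system nat) (T : Type) (D : set T)
    (H P : T -> set (nat * nat)) (f : nat -> nat) (H' P' : set (nat * nat)) :
    Prop := Stage {
  stage_graph : H' = set0 \/ exists h, H' = graph h;
  stage_branches : exists x y z : quad,
    forall w, w <> x -> w <> y -> w <> z ->
      finite_set (H' `&` quad_graph w) /\ finite_set (P' `&` quad_graph w);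
  stage_domain : U (~` (fst @` P'));
  stage_disjoint : forall s, D s ->
    [/\ finite_set (H' `&` H s), finite_set (H' `&` P s),
        finite_set (P' `&` H s) & finite_set (P' `&` P s)];
  stage_disjoint' : finite_set (H' `&` P');
  stage_meets : infinite_set (graph f `&` H') \/
    exists2 s, D s & infinite_set (graph f `&` H s);
  stage_trace : [\/ infinite_set (graph f `&` P'),
    exists2 s, D s & infinite_set (graph f `&` P s) |
    exists J, [/\ J `<=` D, finite_set J &
      finite_set (graph f `\` \bigcup_(s in J) H s)]] }.

Lemma stage_exists (U : set_system nat) (T : choiceType) (D : set T)
    (H P : T -> set (nat * nat)) (f : nat -> nat) :
  a_eq_c -> UltraFilter U -> @frechet_filter nat `<=` U -> small D ->
  (forall s, D s -> exists x y z : quad,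
    forall w, w <> x -> w <> y -> w <> z ->
      finite_set (H s `&` quad_graph w) /\
      finite_set (P s `&` quad_graph w)) ->
  (forall s, D s -> U (~` (fst @` P s))) ->
  (forall s t, D s -> D t -> s <> t -> finite_set (H s `&` H t)) ->
  (forall s t, D s -> D t -> s <> t -> finite_set (P s `&` P t)) ->
  exists H' P', stage U D H P f H' P'.
Proof.
move=> aE Uultra Ucofin Dsmall HPq PU Had Pad.
have quad0 : [set: quad] !=set0 by exists (set0, set0, set0, set0).
have [allH|/existsNP[s0 /not_implyP[Ds0 fs0]]] :=
  pselect (forall s, D s -> finite_set (graph f `&` H s)); last first.
  (* Here [H s0] already meets [f] infinitely, so [H'] is empty and only a promise is sought. *)
  pose promise P' := [/\ P' `<=` graph f,
      exists y : quad, forall w, w <> y -> finite_set (P' `&` quad_graph w),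
      U (~` (fst @` P')),
      (forall s, D s -> finite_set (P' `&` H s)) /\
      (forall s, D s -> finite_set (P' `&` P s)) &
      [\/ infinite_set (graph f `&` P'),
        exists2 s, D s & infinite_set (graph f `&` P s) |
        exists J, [/\ J `<=` D, finite_set J &
          finite_set (graph f `\` \bigcup_(s in J) H s)]]].
  suff [P' [P'f [y Py] P'U [P'H P'P] trace]] : exists P', promise P'.
    exists set0, P'; split => //.
    - by left.
    - by exists y, y, y => w wy _ _; rewrite set0I; split => //; exact: Py.
    - by move=> s Ds; rewrite !set0I; split => //; [exact: P'H|exact: P'P].
    - by rewrite set0I.
    - by right; exists s0.
  have promise0 : (exists2 s, D s & infinite_set (graph f `&` P s)) \/
      (exists J, [/\ J `<=` D, finite_set J &
        finite_set (graph f `\` \bigcup_(s in J) H s)]) -> promise set0.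
    move=> fPH; split => //; last by case: fPH; [exact: Or32|exact: Or33].
    - have [y _] := quad0; exists y => w _; rewrite set0I; exact: finite_set0.
    - by rewrite image_set0 setC0; exact: filterT.
    - by split=> s _; rewrite set0I; exact: finite_set0.
  have [Pf|Pf] := pselect (exists2 s, D s & infinite_set (graph f `&` P s)).
    by exists set0; apply: promise0; left.
  have [Hf|Hf] := pselect (exists J, [/\ J `<=` D, finite_set J &
      finite_set (graph f `\` \bigcup_(s in J) H s)]).
    by exists set0; apply: promise0; right.
  (* No finite set of [H s] almost covers [f], so a = c applies to them; by [Pf], any part of [f] is
     almost disjoint from the earlier promises. *)
  have [|b [bf binf bH]] :=
      small_family_nonmaximal_on (f := f) aE Dsmall Had.
    by move=> J JD Jfin fin; apply: Hf; exists J.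
  have [b1 [y [b1b b1inf b1y]]] := thin_subset finite_quad_branchI binf quad0.
  have [b2 [b2b1 b2inf b2U]] :=
    coideal_domain_subset Uultra (subset_trans b1b bf) b1inf.
  have b2b := subset_trans b2b1 b1b; have b2f := subset_trans b2b bf.
  exists b2; split => //.
  - by exists y => w /b1y; apply: sub_finite_set; exact: setSI.
  - split=> s Ds; first by apply: sub_finite_set (bH s Ds); exact: setSI.
    apply: (@sub_finite_set _ _ (graph f `&` P s)); first exact: setSI.
    by apply: contrapT => fP; apply: Pf; exists s.
  - by apply: Or31; rewrite setIidr.
have [|b [bf binf bP]] := small_family_nonmaximal_on (f := f) aE Dsmall Pad.
  by move=> J JD Jfin; apply: (coideal_domains_uncovered _ Ucofin) => // s /JD/PU.
(* [b1] can meet only the branch [y] infinitely; [c0] will go into [H'], and a part [c2] of [c1]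
   becomes the promise. *)
have [b1 [y [b1b b1inf b1y]]] := thin_subset finite_quad_branchI binf quad0.
have [c0 [c1 [c0b1 c1b1 c01 c0inf c1inf]]] := split_infinite b1inf.
have b1f := subset_trans b1b bf.
have [c2 [c2c1 c2inf c2U]] :=
  coideal_domain_subset Uultra (subset_trans c1b1 b1f) c1inf.
have c2b1 := subset_trans c2c1 c1b1.
have [xyz xyzP] : exists xyz : T -> quad * quad * quad, forall s, D s ->
    forall w, w <> (xyz s).1.1 -> w <> (xyz s).1.2 -> w <> (xyz s).2 ->
      finite_set (H s `&` quad_graph w) /\
      finite_set (P s `&` quad_graph w).
  have [y0 _] := quad0.
  have /choice[g gP] : forall s, exists xyz : quad * quad * quad, D s ->
      forall w, w <> xyz.1.1 -> w <> xyz.1.2 -> w <> xyz.2 ->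
      finite_set (H s `&` quad_graph w) /\ finite_set (P s `&` quad_graph w).
    move=> s; have [Ds|nDs] := pselect (D s); last by exists (y0, y0, y0).
    by have [x1 [x2 [x3 xP]]] := HPq s Ds; exists (x1, x2, x3).
  by exists g.
have [x [xy xD]] := diagonal_quad (fun s => (xyz s).1.1)
  (fun s => (xyz s).1.2) (fun s => (xyz s).2) y Dsmall.
have xfin s : D s -> finite_set (quad_graph x `&` H s) /\
    finite_set (quad_graph x `&` P s).
  move=> Ds; rewrite ![quad_graph x `&` _]setIC.
  by case: (xD s Ds); exact: xyzP.
(* [h] follows [f] on the domain of [c0] and the fresh branch elsewhere, so [graph h] lies between
   [c0] and its union with that branch. Finiteness of intersections is then checked on the two
   pieces. *)
pose h n := if pselect ((fst @` c0) n) then f n else quad_branch x n.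
have c0f := subset_trans c0b1 b1f.
have c0h : c0 `<=` graph h.
  move=> [n m] c0n; rewrite /graph /= /h.
  by case: pselect => [dn|[]] /=; [exact: c0f c0n|exists (n, m)].
have hc0 : graph h `<=` c0 `|` quad_graph x.
  move=> [n m]; rewrite /graph /= /h.
  case: pselect => [[[n' m'] c0n nE]|nc0] /= mE; last by right.
  have m'E : m' = f n' := c0f _ c0n.
  by left; rewrite /= in nE; subst n'; rewrite mE -m'E.
have hI (A : set (nat * nat)) : finite_set (c0 `&` A) ->
    finite_set (quad_graph x `&` A) -> finite_set (graph h `&` A).
  move=> c0A xA; apply: (@sub_finite_set _ _ ((c0 `|` quad_graph x) `&` A)).
    exact: setSI.
  by rewrite setIUl finite_setU.
exists (graph h), c2; split => //.
- by right; exists h.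
(* [x] is exceptional through the completion of [c0], [y] through [b1]. *)
- exists x, y, y => w wx wy _; split.
    apply: hI; last by apply: finite_quad_branchI => /esym.
    by apply: sub_finite_set (b1y w wy); exact: setSI.
  by apply: sub_finite_set (b1y w wy); exact: setSI.
- have bPs (c : set (nat * nat)) s : c `<=` b1 -> D s -> finite_set (c `&` P s).
    move=> cb1 Ds; apply: sub_finite_set (bP s Ds).
    by apply: setSI; exact: subset_trans cb1 b1b.
  have bHs (c : set (nat * nat)) s : c `<=` b1 -> D s -> finite_set (c `&` H s).
    move=> cb1 Ds; apply: sub_finite_set (allH s Ds).
    by apply: setSI; exact: subset_trans cb1 b1f.
  move=> s Ds; have [xH xP] := xfin s Ds.
  by split; [apply: hI|apply: hI|..] => //; (exact: bPs || exact: bHs).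
- apply: hI.
    apply: (@sub_finite_set _ _ (c0 `&` c1)); first exact: setIS.
    by rewrite c01; exact: finite_set0.
  rewrite setIC; apply: sub_finite_set (b1y x xy); exact: setSI.
- left; apply: (sub_infinite_set _ c0inf) => p c0p.
  by split; [exact: c0f|exact: c0h].
- by apply: Or31; rewrite setIidr //; exact: subset_trans c2b1 b1f.
Qed.

(** * Assembling the family *)

Lemma finite_graphs (J : set (set (nat * nat))) :
  finite_set J -> finite_set [set h | J (graph h)].
Proof.
move=> Jfin; apply: (@card_le_finite _ _ _ J) => //.
apply: (@card_ge_preimage _ _ J graph) => g h _ _ gh; apply/funext => n.
by have : graph h (n, g n); [rewrite -gh|].
Qed.

Theorem theorem4 (a_is_c : a_eq_c) :
  exists A : set (nat -> nat), mad_functions A /\ trivial_trace A.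
Proof.
have [U [Uultra Ucofin]] := ultraFilterLemma (@frechet_properfilter_nat).
pose W : Type := nat -> nat.
have Wc : [set: W] #<= [set: set nat].
  have := @card_ge_preimage _ _ [set: set nat] (fun f => pickle @` graph f).
  rewrite preimage_setT; apply; move=> f g _ _ fg; apply/funext => n.
  have [p gp /(pcan_inj pickleK) pE] : (pickle @` graph g) (pickle (n, f n)).
    by rewrite -fg; exists (n, f n).
  by move: gp; rewrite pE.
have [lt [ltwf lttot ltsmall]] := small_segments_order Wc.
pose K := W -> set (nat * nat) * set (nat * nat).
have [HP HPs] : exists HP : K, forall f, stage U [set s | lt s f]
    (fst \o HP) (snd \o HP) f (HP f).1 (HP f).2.
  apply: (@wf_recursive_choice _ _ lt (set0, set0)
    (fun f HP x => stage U [set s | lt s f] (fst \o HP) (snd \o HP) f x.1 x.2)) => //.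
    move=> f F G x FG [x1 x2 x3 x4 x5 x6 x7]; split => //.
    - by move=> s /[dup] sf /x4; rewrite /= FG.
    - by case: x6; [left|move=> [s sf fs]; right; exists s => //; rewrite /= -FG].
    - case: x7 => [?|[s sf fs]|[J [JD Jfin fJ]]].
      + exact: Or31.
      + by apply: Or32; exists s => //; rewrite /= -FG.
      + apply: Or33; exists J; split => //.
        by rewrite -(@eq_bigcupr _ _ J (fst \o F)) // => s /JD /FG /= ->.
  move=> f F Fs; suff [H' [P' HP']] : exists H' P',
      stage U [set s | lt s f] (fst \o F) (snd \o F) f H' P'.
    by exists (H', P').
  apply: stage_exists => //.
  - by move=> s /Fs/stage_branches.
  - by move=> s /Fs/stage_domain.
  - move=> s t /Fs Fs_s /Fs Fs_t /lttot[] lst.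
      by rewrite setIC; have [] := stage_disjoint Fs_t lst.
    by have [] := stage_disjoint Fs_s lst.
  - move=> s t /Fs Fs_s /Fs Fs_t /lttot[] lst.
      by rewrite setIC; have [] := stage_disjoint Fs_t lst.
    by have [] := stage_disjoint Fs_s lst.
pose H f := (HP f).1; pose P f := (HP f).2.
have HH s t : s <> t -> finite_set (H s `&` H t).
  move=> /lttot[] lst; last by have [] := stage_disjoint (HPs s) lst.
  by rewrite setIC; have [] := stage_disjoint (HPs t) lst.
(* Every member respects every promise, whether it was added before, with or after it. *)
have PH s t : finite_set (P s `&` H t).
  have [->|/lttot[] lst] := pselect (s = t).
  - by rewrite setIC; exact: stage_disjoint' (HPs t).
  - by rewrite setIC; have [] := stage_disjoint (HPs t) lst.
  - by have [] := stage_disjoint (HPs s) lst.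
have Hgraph s f : infinite_set (graph f `&` H s) -> exists h, H s = graph h.
  case: (stage_graph (HPs s)) => //; rewrite -/(H s) => ->.
  by rewrite setI0 => /(_ (finite_set0 _)).
(* Stages with empty [H s] contribute no function. *)
exists [set h | exists s, H s = graph h]; split; first split.
- move=> _ _ [g [s sg] <-] [h [t th] <-]; rewrite -sg -th => gh.
  by apply: HH => st; apply: gh; rewrite st.
- move=> f; suff [s fs] : exists s, infinite_set (graph f `&` H s).
    have [h hE] := Hgraph s f fs; exists h; first by exists s.
    by rewrite -hE.
  by case: (stage_meets (HPs f)) => [fs|[s _ fs]]; [exists f|exists s].
- move=> f [_ _ trmax] [_ favoid].
  (* A maximal trace would have some [h] meeting an infinite part of [P s] within [f] infinitely,
     against [PH]. Only the covering case of [stage_trace] remains. *)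
  have noP s : ~ infinite_set (graph f `&` P s).
    move=> fP; have [|_ [h [[t th] fh] <-]] := trmax _ _ fP.
      by move=> p [].
    apply; apply: sub_finite_set (PH s t).
    by rewrite th => p [[_ Pp] [_ hp]].
  case: (stage_trace (HPs f)) => [/noP|[s _ /noP]|[J [_ Jfin fJ]]] //.
  have := favoid [set h | (H @` J) (graph h)]; apply.
  + exact/finite_graphs/finite_image.
  + by move=> h [s _ sh]; exists s.
  + have HJ s : J s -> H s `<=` \bigcup_(h in [set h | (H @` J) (graph h)]) graph h.
      move=> Js; case: (stage_graph (HPs s)) => [|[h hE]].
        by rewrite -/(H s) => -> p.
      by rewrite -/(H s) in hE *; rewrite hE => p hp; exists h => //; exists s.
    apply: sub_finite_set fJ => p [fp np]; split => // -[s Js Hp].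
    by apply: np; exact: HJ Js _ Hp.
Qed.
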